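(* Let $d\ge 1$. For every convex and compact set $K\subset\mathbb R_+^d$ and every $0<\varepsilon\le 1$, there exists an $\varepsilon$-approximate Pareto curve $A\subset K$ for $K$ with $$|A|\le 2^{8d}\left(3+\frac{4\log_2(128/\varepsilon)}{\varepsilon}\right)^{d-1}.$$
   Context: $\mathbb R_+=[0,\infty)$. A finite subset $A\subset K$ is an $\varepsilon$-approximate Pareto curve for $K$ if for every $\theta=(\theta_1,\dots,\theta_d)\in K$ there exists $\phi=(\phi_1,\dots,\phi_d)\in A$ such that $\theta_j\le(1+\varepsilon)\phi_j$ for all $j=1,\dots,d$. *)

(* Defs.v *)
From HB Require Import structures.
From mathcomp Require Import all_boot all_order all_algebra finmap.
From mathcomp Require Import all_classical all_reals all_analysis.

Set Implicit Arguments.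
Unset Strict Implicit.
Unset Printing Implicit Defensive.
Import Order.TTheory GRing.Theory Num.Theory.
Import numFieldNormedType.Exports.
Local Open Scope classical_set_scope.
Local Open Scope ring_scope.

Definition nonneg_orthant (R : realType) (d : nat) : set 'rV[R]_d :=
  [set x | forall j, 0 <= x ord0 j].
Arguments nonneg_orthant : clear implicits.

Definition log2 (R : realType) (x : R) : R := ln x / ln 2.

Definition approx_pareto_curve (R : realType) (d : nat) (eps : R)
    (K : set 'rV[R]_d) (A : {fset 'rV[R]_d}) : Prop :=
  [set` A] `<=` K /\
  forall theta, K theta ->
    exists2 phi, phi \in A &
      forall j, theta ord0 j <= (1 + eps) * phi ord0 j.

(* Main.v *)
(* Let p maximise the product of the coordinates over K. Optimality gives
   sum_j x_j / p_j <= d on K, so after rescaling by p the integer parts of the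
   coordinates of a point sum to at most d and take at most 4^d values jointly.
   Moving a point slightly towards p makes every rescaled coordinate at least
   eps / 4, so once the integer part is fixed O(log(1/eps)/eps) geometric cells
   of ratio 1 + eps / 2 suffice for each coordinate. One coordinate needs no
   grid: in each cell keep a point almost maximising it. *)
Require Import Defs.
From HB Require Import structures.
From mathcomp Require Import all_boot all_order all_algebra finmap.
From mathcomp Require Import all_classical all_reals all_analysis.
From mathcomp Require Import ring lra zify.

Set Implicit Arguments.
Unset Strict Implicit.
Unset Printing Implicit Defensive.
Import Order.TTheory GRing.Theory Num.Theory.
Import numFieldNormedType.Exports.
Local Open Scope classical_set_scope.
Local Open Scope ring_scope.

(** * First-order optimality of a maximiser of the coordinate product *)

Lemma convex_set_comb (R : realType) (M : lmodType R) (K : set M) (x y : M)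
    (t : R) :
  convex_set K -> K x -> K y -> 0 <= t -> t <= 1 ->
  K (t *: x + (1 - t) *: y).
Proof.
move=> cK Kx Ky t0 t1.
by have := cK x y (Itv01 t0 t1) (mem_set Kx) (mem_set Ky); rewrite inE.
Qed.

(** Midpoints suffice: as coordinates on [K] are nonnegative, the midpoint of two points is positive
    wherever one of them is. This makes the maximal product in [exists_balanced_point] positive. *)
Lemma convex_set_pos_coords (R : realType) (d : nat) (K : set 'rV[R]_d)
    (s : seq 'I_d) :
  convex_set K -> K `<=` nonneg_orthant R d -> K !=set0 ->
  (forall j, j \in s -> exists2 x, K x & 0 < x ord0 j) ->
  exists2 p, K p & forall j, j \in s -> 0 < p ord0 j.
Proof.
move=> cK K0 [x0 Kx0]; elim: s => [|j s IHs] posK; first by exists x0.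
have [i si|p Kp p0] := IHs; first by apply: posK; rewrite inE si orbT.
have [|x Kx x0j] := posK j; first exact: mem_head.
exists (2^-1 *: x + (1 - 2^-1) *: p).
  by apply: convex_set_comb => //; lra.
move=> i; rewrite inE !mxE => /predU1P[->|/p0 pi0].
  by have := K0 _ Kp j; lra.
by have := K0 _ Kx i; lra.
Qed.

(** A Taylor lower bound at [t = 0], with [C] independent of [t], in place of a derivative. As
    [-1 <= u i], each factor is nonnegative on [[0, 1]], so the induction may multiply by it. *)
Lemma prod_1Dtx_ge (R : realType) (I : Type) (s : seq I) (u : I -> R) :
  (forall i, -1 <= u i) ->
  exists2 C, 0 <= C & forall t, 0 <= t -> t <= 1 ->
    1 + t * \sum_(i <- s) u i - C * t ^+ 2 <= \prod_(i <- s) (1 + t * u i).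
Proof.
move=> u_ge; elim: s => [|i s [C C0 IHs]].
  by exists 0 => // t _ _; rewrite !big_nil; lra.
set S := \sum_(j <- s) u j in IHs.
exists (`|u i * S| + C + C * `|u i|) => [|t t0 t1].
  by rewrite !addr_ge0 ?mulr_ge0.
rewrite !big_cons -/S.
have fac0 : 0 <= 1 + t * u i by have := u_ge i; nra.
apply: le_trans (ler_wpM2l fac0 (IHs t t0 t1)).
have h1 : - (u i * S) <= `|u i * S| by rewrite -normrN ler_norm.
have h2 : t * (C * u i) <= C * `|u i|.
  apply: (@le_trans _ _ (t * (C * `|u i|))).
    by rewrite !ler_wpM2l ?ler_norm.
  by rewrite ler_piMl ?mulr_ge0.
rewrite -subr_ge0.
have -> : (1 + t * u i) * (1 + t * S - C * t ^+ 2) -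
   (1 + t * (u i + S) - (`|u i * S| + C + C * `|u i|) * t ^+ 2) =
   t ^+ 2 * ((`|u i * S| + u i * S) + (C * `|u i| - t * (C * u i))) by ring.
by rewrite mulr_ge0 ?sqr_ge0 // addr_ge0 //; lra.
Qed.

Lemma sum_le0_of_prod_le1 (R : realType) (I : Type) (s : seq I) (u : I -> R) :
  (forall i, -1 <= u i) ->
  (forall t, 0 <= t -> t <= 1 -> \prod_(i <- s) (1 + t * u i) <= 1) ->
  \sum_(i <- s) u i <= 0.
Proof.
move=> /(@prod_1Dtx_ge R I s)[C C0 lbP] ubP.
set S := \sum_(i <- s) u i in lbP *.
rewrite leNgt; apply/negP => S0.
(* With this [t], [C * t <= S / 2], so the linear gain [t * S] beats the error [C * t ^+ 2]. *)
pose t := S / (S + C + 1) / 2.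
have D0 : 0 < S + C + 1 by lra.
have tE : t * (2 * (S + C + 1)) = S by rewrite /t; field; rewrite gt_eqF.
have t0 : 0 < t by rewrite /t !divr_gt0.
have t1 : t <= 1 by nra.
have := le_trans (lbP t (ltW t0) t1) (ubP t (ltW t0) t1).
have : 0 < t * (S - C * t) by rewrite mulr_gt0 //; nra.
nra.
Qed.

Lemma continuous_prod_coord (R : realType) (d : nat) (s : seq 'I_d) :
  continuous (fun x : 'rV[R]_d => \prod_(j <- s) x ord0 j).
Proof.
elim: s => [|j s IHs].
  rewrite (_ : (fun x => _) = cst 1); first exact: cst_continuous.
  by apply/funext => x; rewrite big_nil.
rewrite (_ : (fun x => _) =
  (fun x : 'rV[R]_d => x ord0 j) \* (fun x => \prod_(k <- s) x ord0 k)).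
  move=> x; apply: continuousM; last exact: IHs.
  exact: (@coord_continuous R 1 d ord0 j x).
by apply/funext => x; rewrite big_cons.
Qed.

(* p maximises the product of the coordinates that do not vanish identically
   on K; the bound is the first-order optimality condition at p. At the other
   coordinates x_j / p_j is 0 / 0 = 0. *)
Lemma exists_balanced_point (R : realType) (d : nat) (K : set 'rV[R]_d) :
  K `<=` nonneg_orthant R d -> convex_set K -> compact K -> K !=set0 ->
  exists p, [/\ K p,
    forall x, K x -> forall j, p ord0 j = 0 -> x ord0 j = 0 &
    forall x, K x -> \sum_j x ord0 j / p ord0 j <= d%:R].
Proof.
move=> K0 cK kK nK.
pose J j := `[< exists2 x, K x & 0 < x ord0 j >].
pose s := [seq j <- enum 'I_d | J j].
have [j|q Kq q0] := convex_set_pos_coords (s := s) cK K0 nK.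
  by rewrite mem_filter => /andP[/asboolP].
pose f (x : 'rV[R]_d) := \prod_(j <- s) x ord0 j.
have [|p] := @compact_EVT_max _ R f K nK kK.
  exact/continuous_subspaceT/continuous_prod_coord.
rewrite inE => Kp maxp.
have fp0 : 0 < f p.
  apply: lt_le_trans (maxp q (mem_set Kq)); rewrite /f big_seq.
  exact: prodr_gt0.
have ps0 j : j \in s -> 0 < p ord0 j.
  move=> sj; rewrite lt_def K0 // andbT.
  move: fp0; rewrite lt_def => /andP[+ _]; rewrite /f prodf_seq_neq0.
  by move=> /allP/(_ j sj).
have xJ x j : K x -> j \notin s -> x ord0 j = 0.
  move=> Kx; rewrite mem_filter mem_enum andbT => /asboolPn nJ.
  apply/eqP; rewrite eq_le K0 // andbT leNgt.
  by apply/negP => x0; apply: nJ; exists x.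
exists p; split=> // x Kx.
  move=> j pj0; apply: xJ => //; apply/negP => /ps0.
  by rewrite pj0 ltxx.
(* Moving from [p] a fraction [t] of the way to [x] multiplies coordinate [j] in [s] by
   [1 + t * u j]. *)
pose u j := x ord0 j / p ord0 j - 1.
have : \sum_(j <- s) u j <= 0.
  apply: sum_le0_of_prod_le1 => [j|t t0 t1].
    by rewrite /u; have := divr_ge0 (K0 _ Kx j) (K0 _ Kp j); lra.
  have := maxp _ (mem_set (convex_set_comb cK Kx Kp t0 t1)).
  have -> : f (t *: x + (1 - t) *: p) = f p * \prod_(j <- s) (1 + t * u j).
    rewrite /f -big_split /=; apply: eq_big_seq => j sj; rewrite !mxE /u.
    by field; rewrite gt_eqF // ps0.
  by rewrite -[leRHS]mulr1 ler_pM2l.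
rewrite sumrB subr_le0 big_const_seq count_predT iter_addr_0 => sum_le.
have -> : \sum_j x ord0 j / p ord0 j = \sum_(j <- s) x ord0 j / p ord0 j.
  rewrite big_filter big_enum_cond /= (bigID J) /= [X in _ + X]big1 ?addr0 //.
  by move=> j nJ; rewrite xJ ?mul0r // mem_filter negb_and nJ.
apply: (le_trans sum_le).
rewrite ler_nat size_filter (leq_trans (count_size _ _)) //.
by rewrite size_enum_ord.
Qed.

(** * Near-maximisers, geometric cells and selection *)

(** Either some element exceeds [sup E / c], or [sup E / c] is itself an upper bound; then [1 < c]
    forces [sup E <= 0] and any element will do. *)
Lemma near_max (R : realType) (E : set R) (c : R) :
  1 < c -> E !=set0 -> has_ubound E -> (forall x, E x -> 0 <= x) ->
  exists2 x, E x & forall y, E y -> y <= c * x.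
Proof.
move=> c1 [e Ee] ubE E0.
have ubs := ub_le_sup ubE.
have [[x Ex ltx]|nE] := pselect (exists2 x, E x & sup E < c * x).
  by exists x => // y /ubs /le_trans -> //; exact: ltW.
have sup_le : sup E <= sup E / c.
  apply: sup_le_ub; first by exists e.
  move=> y Ey; rewrite ler_pdivlMr; last lra.
  by rewrite mulrC leNgt; apply/negP => lty; apply: nE; exists y.
exists e => // y /ubs yle.
have s0 : sup E <= 0.
  by move: sup_le; rewrite ler_pdivlMr; [nra|lra].
by apply: (le_trans yle); apply: (le_trans s0); have := E0 _ Ee; nra.
Qed.

Lemma geometric_cell (R : realType) (b c z : R) (N : nat) :
  b <= z -> z < b * c ^+ N ->
  exists r : 'I_N, b * c ^+ r <= z <= b * c ^+ r.+1.
Proof.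
move=> bz; elim: N => [|N IHN]; first by rewrite mulr1 ltNge bz.
have [/IHN [r rP] _|leN ltN] := ltP z (b * c ^+ N).
  by exists (widen_ord (leqnSn N) r).
by exists ord_max; rewrite leN ltW.
Qed.

(** Used with cells as indices: each cell that has a representative adds at most one point to
    [A]. *)
Lemma seq_selection (I : eqType) (T : choiceType) (s : seq I)
    (P : I -> T -> Prop) :
  exists A : {fset T}, [/\ (#|` A| <= size s)%N,
    forall x, x \in A -> exists i, P i x &
    forall i x, i \in s -> P i x -> exists2 y, y \in A & P i y].
Proof.
elim: s => [|i s [A [szA AP sP]]].
  by exists fset0; split=> // x; rewrite inE.
have [[x Px]|nP] := pselect (exists x, P i x).
  exists (x |` A)%fset; split.
  - by rewrite cardfsU1 /= -add1n leq_add // leq_b1.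
  - by move=> y; rewrite in_fset1U => /predU1P[->|/AP //]; exists i.
  - move=> j y; rewrite inE => /predU1P[-> _|js Pjy].
      by exists x => //; rewrite in_fset1U eqxx.
    by have [w Aw Pw] := sP j y js Pjy; exists w; rewrite // in_fset1U Aw orbT.
exists A; split=> //; first exact: leqW.
by move=> j y; rewrite inE => /predU1P[-> Py|]; [case: nP; exists y|exact: sP].
Qed.

(** * Binomial and logarithmic estimates *)

Lemma bin_le_exp2 (m k : nat) : ('C(m, k) <= 2 ^ m)%N.
Proof.
elim: m k => [|m IHm] [|k] //; first by rewrite bin0 expn_gt0.
by rewrite binS expnS mul2n -addnn leq_add.
Qed.

(** This is [ln (1 + y) <= y] at [y = - (x / (1 + x))], where [1 + y] is the inverse of [1 + x]. *)
Lemma ln1D_ge (R : realType) (x : R) : 0 <= x -> x / (1 + x) <= ln (1 + x).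
Proof.
move=> x0; have x1 : 0 < 1 + x by lra.
have lt_x : x / (1 + x) < 1 by rewrite ltr_pdivrMr // mul1r; lra.
have := @le_ln1Dx R (- (x / (1 + x))) ltac:(lra).
have -> : 1 + - (x / (1 + x)) = (1 + x)^-1 by field; rewrite gt_eqF.
by rewrite lnV // lerN2.
Qed.

Lemma grid_size (R : realType) (eps : R) : 0 < eps -> eps <= 1 ->
  exists2 N : nat, N%:R <= 3 + 4 * log2 (128 / eps) / eps &
    4 / eps <= (1 + eps / 2) ^+ N.
Proof.
move=> e0 e1; set X := 3 + _.
have q0 : 0 < 128 / eps by rewrite divr_gt0.
have q1 : 4 / eps <= 128 / eps by rewrite ler_pM2r ?invr_gt0 // ler_nat.
have q2 : 1 <= 128 / eps by rewrite ler_pdivlMr // mul1r; lra.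
have l0 : 0 <= ln (128 / eps) by exact: ln_ge0.
have l2 : 0 < ln (2 : R) by rewrite ln_gt0 // ltr1n.
have l2' : ln (2 : R) <= 1.
  by have := @le_ln1Dx R 1 ltac:(lra); rewrite -[1 + 1]/(2 : R).
have log_ge : ln (128 / eps) <= log2 (128 / eps).
  by rewrite /log2 ler_pdivlMr // ler_piMr.
have X0 : 0 <= X.
  have := divr_ge0 (le_trans l0 log_ge) (ltW e0).
  by rewrite /X -mulrA; lra.
have /andP[N1 N2] := truncn_itv X0.
exists (Num.trunc X) => //; set N := Num.trunc X in N1 N2 *.
(* The summand [3] in [X] absorbs the loss from rounding down. *)
have NX : 4 * ln (128 / eps) <= N%:R * eps.
  have : 4 * log2 (128 / eps) / eps <= N%:R.
    by move: N2; rewrite /X -natr1; lra.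
  by rewrite ler_pdivrMr //; lra.
have c0 : 0 < 1 + eps / 2 by lra.
rewrite -ler_ln ?posrE ?exprn_gt0 ?divr_gt0 // lnXn //.
apply: (@le_trans _ _ (ln (128 / eps)));
  first by rewrite ler_ln ?posrE ?divr_gt0.
rewrite -[leRHS]mulr_natl.
(* At [eps / 2], [ln1D_ge] gives [eps / (2 + eps)], at least [eps / 3] because [eps <= 1]. The
   factor [4] in [NX] outweighs this [3]. *)
have le_ln : eps / 3 <= ln (1 + eps / 2).
  apply: le_trans (ln1D_ge _); last lra.
  by rewrite ler_pdivlMr //; nra.
have := ler_wpM2l (ler0n R N) le_ln.
by lra.
Qed.


(** * The grid and its representatives *)

(* C(n + d, n) counts the vectors of integer parts, with d = n.+1, and N ^ n
   the positions in the geometric grids. *)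
Lemma pareto_grid (R : realType) (n N : nat) (K : set 'rV[R]_n.+1)
    (delta c : R) :
  K `<=` nonneg_orthant R n.+1 -> convex_set K -> compact K -> K !=set0 ->
  0 < delta -> delta <= 2^-1 -> 1 < c -> delta^-1 <= c ^+ N ->
  exists A : {fset 'rV[R]_n.+1}, [/\ [set` A] `<=` K,
    (#|` A| <= 'C(n + n.+1, n) * N ^ n)%N &
    forall x, K x -> exists2 y, y \in A &
      forall j, (1 - delta) * x ord0 j <= c * y ord0 j].
Proof.
move=> K0 cK kK nK d0 d2 c1 cN.
have c0 : 0 < c by lra.
have N0 : (0 < N)%N.
  case: N cN => // /le_trans/(_ (lexx _)).
  by rewrite expr0 invf_le1 //; lra.
have [p [Kp px0 sum_le]] := exists_balanced_point K0 cK kK nK.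
(* A key gives, for each coordinate except [ord0], an integer part, at most [n.+1], and a grid
   position. *)
pose key := (n.-tuple 'I_n.+2 * {ffun 'I_n -> 'I_N})%type.
(* A geometric grid cannot start at 0, so integer part 0 starts at [delta]. *)
pose lo (k : key) (i : 'I_n) := p ord0 (lift ord0 i) * Num.max (tnth k.1 i)%:R delta.
pose cell (k : key) x := K x /\ forall i : 'I_n,
  lo k i * c ^+ k.2 i <= x ord0 (lift ord0 i) <= lo k i * c ^+ (k.2 i).+1.
pose rep k y := cell k y /\ forall x, cell k x -> x ord0 ord0 <= c * y ord0 ord0.
have cell_rep k x : cell k x -> exists y, rep k y.
  move=> kx; pose E := [set y ord0 ord0 | y in cell k].
  have [|||_ [y ky <-] yP] := @near_max _ E c c1.
  - by exists (x ord0 ord0), x.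
  - exists (n.+1%:R * p ord0 ord0) => _ [y [Ky _] <-].
    have [/px0->//|pn0] := eqVneq (p ord0 ord0) 0.
      by rewrite mulr_ge0 // K0.
    have p0 : 0 < p ord0 ord0 by rewrite lt_def pn0 K0.
    rewrite -ler_pdivrMr // (le_trans _ (sum_le _ Ky)) //.
    rewrite big_ord_recl lerDl sumr_ge0 // => i _.
    by rewrite divr_ge0 ?K0.
  - by move=> _ [y [Ky _] <-]; exact: K0.
  by exists y; split=> // z kz; apply: yP; exists z.
pose S := finset.setX [set t : n.-tuple 'I_n.+2 | (\sum_(i <- t) i <= n.+1)%N]%SET
  [set: {ffun 'I_n -> 'I_N}]%SET.
have [A [szA AP sP]] := seq_selection (enum S) rep.
exists A; split.
- by move=> y /AP[k [[]]].
- rewrite (leq_trans szA) // -cardE cardsX card_partial_ord_partitions.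
  by rewrite cardsT card_ffun !card_ord.
move=> x Kx.
pose x' := delta *: p + (1 - delta) *: x.
have Kx' : K x' by apply: convex_set_comb => //; lra.
pose z i := x' ord0 (lift ord0 i) / p ord0 (lift ord0 i).
have z0 i : 0 <= z i by rewrite divr_ge0 // K0.
have zP i : exists ar : nat * 'I_N, ar.1%:R <= z i /\
    p ord0 (lift ord0 i) * Num.max ar.1%:R delta * c ^+ ar.2
      <= x' ord0 (lift ord0 i)
      <= p ord0 (lift ord0 i) * Num.max ar.1%:R delta * c ^+ ar.2.+1.
  (* Where [p] vanishes so does [x']: both cell bounds are 0 and any position works. *)
  have [p0|pn0] := eqVneq (p ord0 (lift ord0 i)) 0.
    by exists (0%N, Ordinal N0); rewrite z0 (px0 _ Kx') // p0 !mul0r lexx.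
  have p0 : 0 < p ord0 (lift ord0 i) by rewrite lt_def pn0 K0.
  have zd : delta <= z i.
    rewrite /z ler_pdivlMr // !mxE lerDl mulr_ge0 ?K0 //; lra.
  have /andP[az za] := truncn_itv (z0 i); set a := Num.trunc _ in az za.
  set b := Num.max a%:R delta.
  have bz : b <= z i by rewrite ge_max az zd.
  have zb : z i < b * c ^+ N.
    have b0 : 0 < b by rewrite lt_max d0 orbT.
    (* It suffices that [a + 1 <= b / delta]: an equality for [a = 0], and for [a >= 1] a
       consequence of [delta <= 1/2] and [a + 1 <= 2 * a]. *)
    apply: lt_le_trans (ler_wpM2l (ltW b0) cN).
    apply: (lt_le_trans za); rewrite ler_pdivlMr // /b.
    have [->|a0] := posnP a; first by rewrite mul1r le_max lexx orbT.
    rewrite le_max; apply/orP; left.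
    have : 1 <= a%:R :> R by rewrite ler1n.
    by rewrite -natr1; nra.
  have [r /andP[r1 r2]] := geometric_cell bz zb.
  exists (a, r); split=> //=.
  have -> : x' ord0 (lift ord0 i) = p ord0 (lift ord0 i) * z i.
    by rewrite /z mulrC divfK.
  by rewrite -!mulrA !ler_pM2l // r1 r2.
have [f fP] := choice zP.
have sumf : (\sum_i (f i).1 <= n.+1)%N.
  rewrite -(ler_nat R) natr_sum (le_trans _ (sum_le _ Kx')) //.
  rewrite big_ord_recl ler_wpDl ?divr_ge0 ?K0 //.
  by apply: ler_sum => i _; have [] := fP i.
have f_lt i : ((f i).1 < n.+2)%N.
  by rewrite ltnS (leq_trans _ sumf) // (bigD1 i) //= leq_addr.
pose k : key := ([tuple inord (f i).1 | i < n], [ffun i => (f i).2]).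
have k1 i : tnth k.1 i = (f i).1 :> nat by rewrite tnth_mktuple inordK.
have kx' : cell k x'.
  by split=> // i; rewrite /lo k1 ffunE; have [] := fP i.
have kS : k \in enum S.
  rewrite mem_enum finset.in_setX !inE andbT.
  by rewrite big_tuple; under eq_bigr do rewrite k1.
have [y0 y0P] := cell_rep _ _ kx'.
have [y Ay [[Ky yk] ymax]] := sP k y0 kS y0P.
exists y => // j; apply: (@le_trans _ _ (x' ord0 j)).
  by rewrite !mxE lerDr mulr_ge0 ?K0 // ltW.
(* Off [ord0], [x'] and [y] share a cell of ratio [c]; at [ord0], [y] is maximal in that cell up to
   [c]. *)
case: (unliftP ord0 j) => [i|] ->; last exact: ymax.
have /andP[_ /le_trans] := kx'.2 i; apply.
have /andP[+ _] := yk i.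
by rewrite exprS mulrCA ler_pM2l.
Qed.

Theorem corollary2 (R : realType) (d : nat) (hd : (1 <= d)%N)
    (K : set 'rV[R]_d) (K_nonneg : K `<=` nonneg_orthant R d)
    (K_convex : convex_set K) (K_compact : compact K)
    (eps : R) (eps_gt0 : 0 < eps) (eps_le1 : eps <= 1) :
  exists A : {fset 'rV[R]_d},
    approx_pareto_curve eps K A /\
    (#|` A|%fset)%:R <=
      2 ^+ (8 * d) * (3 + 4 * log2 (128 / eps) / eps) ^+ (d - 1) :> R.
Proof.
have [N NX cN] := grid_size eps_gt0 eps_le1.
set X := 3 + _ in NX *.
have X0 : 0 <= X by exact: le_trans NX.
have [nK|K0] := pselect (K !=set0); last first.
  exists fset0; split; last by rewrite cardfs0 mulr_ge0 ?exprn_ge0.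
  split=> [x /=|x Kx]; first by rewrite inE.
  by case: K0; exists x.
case: d hd K K_nonneg K_convex K_compact nK => // n _ K K_nonneg cK kK nK.
have [||||A [AK szA AP]] :=
  @pareto_grid R n N K (eps / 4) (1 + eps / 2) K_nonneg cK kK nK;
  [lra|lra|lra|by rewrite invf_div|].
exists A; split; first split=> //.
  move=> x /AP[y Ay yP]; exists y => // j.
  have y0 := K_nonneg _ (AK _ Ay) j.
  have d0 : 0 < 1 - eps / 4 by lra.
  (* The choice of constants gives [1 + eps / 2 <= (1 + eps) * (1 - eps / 4)], by [eps <= 1]. *)
  rewrite -(ler_pM2l d0) (le_trans (yP j)) // mulrA ler_wpM2r //; nra.
rewrite subn1 /=.
apply: (@le_trans _ _ ('C(n + n.+1, n) * N ^ n)%:R); first by rewrite ler_nat.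
rewrite natrM ler_pM // ?natrX; last by rewrite lerXn2r ?nnegrE.
rewrite -natrX ler_nat (leq_trans (bin_le_exp2 _ _)) // leq_exp2l //.
by lia.
Qed.
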